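(* For the $2$-user symmetric linear deterministic Z interference channel with unidirectional, rate-limited transmitter cooperation of capacity $C$ from transmitter $2$ to transmitter $1$ (any nonnegative integers $m\ge1$, $n$, $C$), $$\mathcal{C}^{\text{perfect}}=\mathcal{C}^{\text{strong}}=\mathcal{C}^{\text{weak}},$$ where these are the capacity regions under the perfect, strong and weak secrecy constraints at the receivers, respectively.
   Context: Model: let $q=\max\{m,n\}$ and let $\mathbf{D}$ be the $q\times q$ downshift matrix over $\mathbb{F}_2$ (entries $d_{j',j''}=1$ if $2\le j'=j''+1\le q$, and $0$ otherwise). At each channel use, transmitter $i$ sends $\mathbf{x}_i\in\mathbb{F}_2^q$, and the outputs are $\mathbf{y}_1=\mathbf{D}^{q-m}\mathbf{x}_1\oplus\mathbf{D}^{q-n}\mathbf{x}_2$ and $\mathbf{y}_2=\mathbf{D}^{q-m}\mathbf{x}_2$, where $\oplus$ is componentwise addition mod $2$. Transmitter $i$ has a message $W_i$ uniform on $\{1,\dots,2^{NR_i}\}$ ($N$ = block length). Transmitter $2$ can send to transmitter $1$, over a noiseless secure link, at most $C$ bits per channel use; transmitter $2$'s signal depends only on $W_2$ (and possibly its own randomness), while transmitter $1$'s signal at each time is a function of $W_1$, the bits received so far over the cooperative link (causality), and possibly locally generated random bits. Receiver $i$ decodes $W_i$ from $\mathbf{y}_i^N$. A rate pair is achievable under a given secrecy notion if there exist such codes with error probability $\to0$ as $N\to\infty$ and, for $i\ne j$: (perfect) $I(W_i;\mathbf{y}_j^N)=0$; (strong) $I(W_i;\mathbf{y}_j^N)\to0$;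 (weak) $\frac1N I(W_i;\mathbf{y}_j^N)\to0$, as $N\to\infty$. Each capacity region is the closure of the corresponding set of achievable rate pairs. *)

(* Defs.v *)
From HB Require Import structures.
From mathcomp Require Import all_boot all_order all_algebra.
From mathcomp Require Import all_classical all_reals all_analysis.
Set Implicit Arguments. Unset Strict Implicit. Unset Printing Implicit Defensive.
Import Order.TTheory GRing.Theory Num.Theory.
Import numFieldNormedType.Exports.
Local Open Scope classical_set_scope.
Local Open Scope ring_scope.

Definition downshift (q : nat) : 'M['F_2]_q :=
  \matrix_(i < q, j < q) (((i : nat) == (j : nat).+1)%:R).

(* k-th power of a square matrix (works for every size, incl. q = 0). *)
Definition mxpow (q : nat) (A : 'M['F_2]_q) (k : nat) : 'M['F_2]_q :=
  iter k (mulmx A) 1%:M.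

Definition qdim (m n : nat) : nat := maxn m n.

Definition out1 (m n : nat) (x1 x2 : 'cV['F_2]_(qdim m n)) : 'cV['F_2]_(qdim m n) :=
  mxpow (downshift (qdim m n)) (qdim m n - m) *m x1
  + mxpow (downshift (qdim m n)) (qdim m n - n) *m x2.

Definition out2 (m n : nat) (x2 : 'cV['F_2]_(qdim m n)) : 'cV['F_2]_(qdim m n) :=
  mxpow (downshift (qdim m n)) (qdim m n - m) *m x2.

(* Block length N, M1/M2 messages, C cooperation bits per channel use.
   Transmitter i uses k_i uniformly distributed local random bits.
   Transmitter 2: channel input and cooperation bits are functions of (W2, its
   random bits).  Transmitter 1: input at time t is a function of W1, its
   random bits, and the cooperation bits received in slots s < t (causality). *)
Record code (m n C N M1 M2 : nat) := Code {
  k1 : nat;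
  k2 : nat;
  enc2 : 'I_M2 -> k2.-tuple bool -> 'I_N -> 'cV['F_2]_(qdim m n);
  coop : 'I_M2 -> k2.-tuple bool -> 'I_N -> C.-tuple bool;
  enc1 : 'I_M1 -> k1.-tuple bool -> ('I_N -> C.-tuple bool) -> 'I_N ->
         'cV['F_2]_(qdim m n);
  enc1_causal : forall w r (v v' : 'I_N -> C.-tuple bool) (t : 'I_N),
      (forall s : 'I_N, (s < t)%N -> v s = v' s) -> enc1 w r v t = enc1 w r v' t;
  dec1 : {ffun 'I_N -> 'cV['F_2]_(qdim m n)} -> 'I_M1;
  dec2 : {ffun 'I_N -> 'cV['F_2]_(qdim m n)} -> 'I_M2
}.
Arguments k1 {m n C N M1 M2} c.
Arguments k2 {m n C N M1 M2} c.
Arguments enc1 {m n C N M1 M2} c _ _ _ _.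
Arguments enc2 {m n C N M1 M2} c _ _ _.
Arguments coop {m n C N M1 M2} c _ _ _.
Arguments dec1 {m n C N M1 M2} c _.
Arguments dec2 {m n C N M1 M2} c _.

(* Underlying uniform probability space: (W1, W2, random bits 1, random bits 2). *)
Definition omega m n C N M1 M2 (c : code m n C N M1 M2) : finType :=
  ('I_M1 * 'I_M2 * (k1 c).-tuple bool * (k2 c).-tuple bool)%type.

Definition W1of m n C N M1 M2 (c : code m n C N M1 M2) (o : omega c) : 'I_M1 :=
  o.1.1.1.
Definition W2of m n C N M1 M2 (c : code m n C N M1 M2) (o : omega c) : 'I_M2 :=
  o.1.1.2.

Definition x1seq m n C N M1 M2 (c : code m n C N M1 M2) (o : omega c) (t : 'I_N) :=
  enc1 c o.1.1.1 o.1.2 (coop c o.1.1.2 o.2) t.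
Definition x2seq m n C N M1 M2 (c : code m n C N M1 M2) (o : omega c) (t : 'I_N) :=
  enc2 c o.1.1.2 o.2 t.

Definition y1of m n C N M1 M2 (c : code m n C N M1 M2) (o : omega c)
  : {ffun 'I_N -> 'cV['F_2]_(qdim m n)} :=
  [ffun t => @out1 m n (x1seq o t) (x2seq o t)].
Definition y2of m n C N M1 M2 (c : code m n C N M1 M2) (o : omega c)
  : {ffun 'I_N -> 'cV['F_2]_(qdim m n)} :=
  [ffun t => @out2 m n (x2seq o t)].

Definition prob {R : realType} (T : finType) (E : pred T) : R :=
  #|[set x | E x]|%:R / #|T|%:R.

Definition mutinf {R : realType} (T TA TB : finType) (A : T -> TA) (B : T -> TB) : R :=
  \sum_(a : TA) \sum_(b : TB)
    (let pab := prob (R := R) [pred x | (A x == a) && (B x == b)] in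
     let pa := prob (R := R) [pred x | A x == a] in
     let pb := prob (R := R) [pred x | B x == b] in
     if pab == 0 then 0 else pab * ln (pab / (pa * pb))).

Definition Perr {R : realType} m n C N M1 M2 (c : code m n C N M1 M2) : R :=
  prob (R := R) [pred o : omega c |
     (dec1 c (y1of o) != W1of o) || (dec2 c (y2of o) != W2of o)].

Definition leak1 {R : realType} m n C N M1 M2 (c : code m n C N M1 M2) : R :=
  mutinf (R := R) (@W1of _ _ _ _ _ _ c) (@y2of _ _ _ _ _ _ c).
Definition leak2 {R : realType} m n C N M1 M2 (c : code m n C N M1 M2) : R :=
  mutinf (R := R) (@W2of _ _ _ _ _ _ c) (@y1of _ _ _ _ _ _ c).

Definition msgs {R : realType} (N : nat) (r : R) : nat :=
  `|Num.ceil ((2 : R) `^ (N%:R * r))|%N.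

Inductive secrecy := Perfect | Strong | Weak.

Definition secrecy_ok {R : realType} (s : secrecy) (l1 l2 : nat -> R) : Prop :=
  match s with
  | Perfect => forall N, l1 N = 0 /\ l2 N = 0
  | Strong => l1 @ \oo --> (0 : R) /\ l2 @ \oo --> (0 : R)
  | Weak => (fun N => l1 N / N%:R) @ \oo --> (0 : R) /\
            (fun N => l2 N / N%:R) @ \oo --> (0 : R)
  end.

Definition achievable {R : realType} (m n C : nat) (s : secrecy) (r : R * R) : Prop :=
  0 <= r.1 /\ 0 <= r.2 /\
  exists cd : forall N : nat, code m n C N (msgs N r.1) (msgs N r.2),
    (fun N => Perr (R := R) (cd N)) @ \oo --> (0 : R) /\
    secrecy_ok s (fun N => leak1 (R := R) (cd N)) (fun N => leak2 (R := R) (cd N)).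

Definition capacity_region {R : realType} (m n C : nat) (s : secrecy) : set (R * R) :=
  closure [set r : R * R | achievable m n C s r].

(* Main.v *)
(* Receiver 2 sees nothing of transmitter 1, so only the secrecy of W2 at
   receiver 1 matters, and all three regions are the polygon
     R1 <= m,  R2 <= (m - (n - m)^+)^+,  R1 + R2 <= m + (m - n)^+ + C.
   Converse under weak secrecy: let A be the top (n - m)^+ levels of receiver 1,
   out of reach of transmitter 1, S the interference, X the contribution of
   transmitter 1 and V the cooperation bits.  Given (W1, V), X and S are
   independent, and adding X can only hide S as much as it randomises y1:
     H(S | y1, V, W1) <= H(y1 | W1, A).
   With Fano's inequality this bounds R1 + R2.
   Achievability with zero leakage: transmitter 1 cancels min(C, s) of the s
   levels where its signal meets useful bits of transmitter 2, and on any chosen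
   subset of the other such (time, level) positions it replaces its data by fresh
   noise, which acts as a one-time pad.  Varying the size of this subset and
   the number of messages sweeps out the polygon up to its boundary. *)
Require Import Defs.
From HB Require Import structures.
From mathcomp Require Import all_boot all_order all_algebra.
From mathcomp Require Import all_classical all_reals all_analysis.
From mathcomp Require Import ring lra zify.
Set Implicit Arguments. Unset Strict Implicit. Unset Printing Implicit Defensive.
Import Order.TTheory GRing.Theory Num.Theory.
Import numFieldNormedType.Exports.
Local Open Scope ring_scope.

(** * Entropy on a finite uniform probability space *)

Section Entropy.
Variables (R : realType) (T : finType).

Definition fibre (U : eqType) (X : T -> U) (o : T) : nat :=
  #|[pred x | X x == X o]|.

Lemma fibre_gt0 (U : eqType) (X : T -> U) o : (0 < fibre X o)%N.
Proof. by apply/card_gt0P; exists o; rewrite inE. Qed.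

Lemma eq_fibre (U : eqType) (X : T -> U) o o' : X o = X o' -> fibre X o = fibre X o'.
Proof. by rewrite /fibre => ->. Qed.

Definition determines (U V : Type) (X : T -> U) (Y : T -> V) : Prop :=
  forall o o', X o = X o' -> Y o = Y o'.

Lemma fibre_determines (U V : eqType) (X : T -> U) (Y : T -> V) o :
  determines X Y -> (fibre X o <= fibre Y o)%N.
Proof.
by move=> XY; apply/subset_leq_card/fintype.subsetP => x; rewrite !inE => /eqP /XY ->.
Qed.

Lemma ln_le_subr1 (x : R) : 0 < x -> ln x <= x - 1.
Proof.
move=> x0; have := @expR_ge1Dx R (ln x); rewrite lnK ?posrE //; lra.
Qed.

Lemma sum_fibreV (U : eqType) (X : T -> U) (u : U) :
  \sum_(o | X o == u) ((fibre X o)%:R : R)^-1 <= 1.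
Proof.
have [ o /eqP Xo|no] := pickP [pred o | X o == u]; last by rewrite big_pred0.
rewrite (eq_bigr (fun=> ((fibre X o)%:R : R)^-1)); last first.
  by move=> x /eqP Xx; rewrite (@eq_fibre _ _ x o) // Xx Xo.
rewrite sumr_const (_ : #|_| = fibre X o); last first.
  by apply: eq_card => x; rewrite !inE -Xo.
by rewrite -[leLHS]mulr_natl divff // pnatr_eq0 -lt0n fibre_gt0.
Qed.

(** Shannon entropy in nats, averaged over outcomes instead of values: no value of probability zero
    occurs, and the codomain need not be finite. *)
Definition ent (U : eqType) (X : T -> U) : R :=
  (\sum_o ln (#|T|%:R / (fibre X o)%:R)) / #|T|%:R.

Lemma card_fibre_gt0 (U : eqType) (X : T -> U) o :
  (0 < (#|T|%:R : R)) /\ 0 < ((fibre X o)%:R : R).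
Proof. by rewrite !ltr0n fibre_gt0 ; split => //; apply/card_gt0P; exists o. Qed.

Lemma ent_determines (U V : eqType) (X : T -> U) (Y : T -> V) :
  determines X Y -> ent Y <= ent X.
Proof.
move=> XY; rewrite ler_wpM2r ?invr_ge0 ?ler0n //; apply: ler_sum => o _.
have [T0 X0] := card_fibre_gt0 X o; have [_ Y0] := card_fibre_gt0 Y o.
rewrite ler_ln ?posrE ?divr_gt0 // ler_pM2l // lef_pV2 ?posrE //.
by rewrite ler_nat fibre_determines.
Qed.

(** Submodularity, by [ln x <= x - 1] at the ratio of fibre sizes. With [XY] and [Z] constrained
    only through [determines], it covers every regrouping of components, and the converse is a
    sequence of its instances. *)
Lemma ent_submod (U V J K : eqType) (X : T -> U) (Y : T -> V) (XY : T -> J) (Z : T -> K) :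
  determines (fun o => (X o, Y o)) XY -> determines X Z -> determines Y Z ->
  ent XY + ent Z <= ent X + ent Y.
Proof.
move=> dXY dXZ dYZ; pose P := (fun o => (X o, Y o)).
apply: (@le_trans _ _ (ent P + ent Z)); first by rewrite lerD2r ent_determines.
rewrite -!mulrDl ler_wpM2r ?invr_ge0 ?ler0n // -!big_split /= -subr_le0 -sumrB.
apply: (@le_trans _ _ (\sum_o ((fibre X o)%:R * (fibre Y o)%:R
                            / ((fibre P o)%:R * (fibre Z o)%:R) - 1))).
  apply: ler_sum => o _.
  have [T0 X0] := card_fibre_gt0 X o; have [_ Y0] := card_fibre_gt0 Y o.
  have [_ P0] := card_fibre_gt0 P o; have [_ Z0] := card_fibre_gt0 Z o.
  have rat0 : 0 < (fibre X o)%:R * (fibre Y o)%:R / ((fibre P o)%:R * (fibre Z o)%:R) :> R.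
    by rewrite divr_gt0 ?mulr_gt0.
  have := ln_le_subr1 rat0; rewrite !ln_div ?lnM ?posrE ?mulr_gt0 //; lra.
rewrite sumrB sumr_const -[1 *+ _]/(#|T|%:R) subr_le0.
have cardE (L : eqType) (Q : T -> L) o :
    ((fibre Q o)%:R : R) = \sum_(o' | Q o' == Q o) 1 by rewrite sumr_const.
(* Expand the sizes of the [X]- and [Y]-fibres as sums over [o1] and [o2], then sum over [o] first:
   [o1] and [o2] fix [P o] and must agree under [Z], so each [o1] contributes at most 1. *)
under eq_bigr => o _.
  rewrite (cardE _ X) (cardE _ Y) mulr_suml mulr_suml.
  under eq_bigr do rewrite mul1r mulr_suml.
  over.
rewrite (exchange_big_dep predT) //=.
apply: (@le_trans _ _ (\sum_(o1 : T) 1)); last by rewrite sumr_const.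
apply: ler_sum => o1 _.
rewrite (exchange_big_dep [pred o2 | Z o2 == Z o1]) /=; last first.
  move=> o o2 /eqP Xo /eqP Yo; apply/eqP; rewrite (dXZ _ _ Xo); exact: dYZ.
apply: (@le_trans _ _ (\sum_(o2 | Z o2 == Z o1) ((fibre Z o1)%:R)^-1)); last first.
  rewrite sumr_const (_ : #|_| = fibre Z o1) // -[leLHS]mulr_natl divff //.
  by rewrite pnatr_eq0 -lt0n fibre_gt0.
apply: ler_sum => o2 /eqP Zo2.
rewrite (eq_bigl (fun o => P o == (X o1, Y o2))); last first.
  by move=> o; rewrite /P xpair_eqE eq_sym (eq_sym (Y o2)).
rewrite (eq_bigr (fun o => ((fibre P o)%:R)^-1 * ((fibre Z o1)%:R)^-1)); last first.
  move=> o /eqP [Xo Yo]; rewrite mul1r invfM; congr (_ * _).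
  by rewrite (@eq_fibre _ Z o o1) // (dXZ _ _ Xo).
by rewrite -mulr_suml -[leRHS]mul1r ler_wpM2r ?invr_ge0 ?ler0n // sum_fibreV.
Qed.

Lemma ent_const (U : eqType) (X : T -> U) : determines (fun=> tt) X -> ent X = 0.
Proof.
move=> dX; rewrite /ent big1 ?mul0r // => o _.
have -> : fibre X o = #|T|.
  by apply: eq_card => x; rewrite !inE (dX x o) // eqxx.
by rewrite divff ?ln1 // gt_eqF // (card_fibre_gt0 X o).1.
Qed.

Lemma ent_pair_le (U V J : eqType) (X : T -> U) (Y : T -> V) (XY : T -> J) :
  determines (fun o => (X o, Y o)) XY -> ent XY <= ent X + ent Y.
Proof.
move=> d; have := @ent_submod _ _ _ _ X Y XY (fun=> tt) d.
by rewrite (@ent_const _ (fun=> tt)) // addr0; apply.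
Qed.

(* Gibbs' inequality for the conditional law of [X] given [Y] against a
   sub-stochastic kernel [q]. *)
Lemma ent_cond_le (U : finType) (V : eqType) (X : T -> U) (Y : T -> V) (q : U -> V -> R) :
  (forall u v, 0 < q u v) -> (forall v, \sum_u q u v <= 1) ->
  ent (fun o => (X o, Y o)) - ent Y <= (\sum_o - ln (q (X o) (Y o))) / #|T|%:R.
Proof.
move=> q0 q1; pose P := (fun o => (X o, Y o)).
rewrite -mulrBl ler_wpM2r ?invr_ge0 ?ler0n // -sumrB -subr_le0 -sumrB.
apply: (@le_trans _ _ (\sum_o (q (X o) (Y o) * (fibre Y o)%:R / (fibre P o)%:R - 1))).
  apply: ler_sum => o _.
  have [T0 P0] := card_fibre_gt0 P o; have [_ Y0] := card_fibre_gt0 Y o.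
  have rat0 : 0 < q (X o) (Y o) * (fibre Y o)%:R / (fibre P o)%:R :> R.
    by rewrite divr_gt0 ?mulr_gt0.
  have := ln_le_subr1 rat0; rewrite !ln_div ?lnM ?posrE ?mulr_gt0 //; lra.
rewrite sumrB sumr_const -[1 *+ _]/(#|T|%:R) subr_le0.
apply: (@le_trans _ _ (\sum_(o1 : T) 1)); last by rewrite sumr_const.
rewrite (eq_bigr (fun o =>
    \sum_(o1 | Y o1 == Y o) q (X o) (Y o) / (fibre P o)%:R)); last first.
  by move=> o _; rewrite sumr_const -[RHS]mulr_natr mulrAC.
rewrite (exchange_big_dep predT) //=; apply: ler_sum => o1 _.
apply: le_trans (q1 (Y o1)).
rewrite (partition_big X predT) //=; apply: ler_sum => u _.
rewrite (eq_bigl (fun o => P o == (u, Y o1))); last first.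
  by move=> o; rewrite /P xpair_eqE andbC (eq_sym (Y o1)).
rewrite (eq_bigr (fun o => q u (Y o1) * ((fibre P o)%:R)^-1)); last first.
  by move=> o /eqP [-> ->].
by rewrite -mulr_sumr -[leRHS]mulr1 ler_wpM2l ?sum_fibreV // ltW.
Qed.

(** Gibbs' inequality against the uniform law, with trivial conditioning. *)
Lemma ent_le_ln_card (U : finType) (X : T -> U) : ent X <= ln #|U|%:R.
Proof.
have [/eqP T0|] := boolP (#|T| == 0)%N.
  rewrite /ent T0 invr0 mulr0; case: (posnP #|U|) => [->|U0]; first by rewrite ln0.
  by rewrite ln_ge0 // ler1n.
rewrite -lt0n => T0; have U0 : (0 < #|U|)%N.
  by have /card_gt0P [ o _] := T0; apply/card_gt0P; exists (X o).
have U0' : (#|U|%:R : R) != 0 by rewrite pnatr_eq0 -lt0n.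
have := @ent_cond_le U _ X (fun=> tt) (fun _ _ => #|U|%:R^-1).
rewrite (@ent_const _ (fun=> tt)) // subr0.
have -> : ent (fun o => (X o, tt)) = ent X.
  apply/eqP; rewrite eq_le; apply/andP.
  by split; apply: ent_determines => o o' /=; [move=> ->|case].
move=> le_q; apply: le_trans (le_q _ _) _.
- by move=> _ _; rewrite invr_gt0 ltr0n.
- by move=> _; rewrite sumr_const -[leLHS]mulr_natl divff.
rewrite sumr_const lnV ?posrE ?ltr0n // opprK -[X in X * _]mulr_natr mulfK //.
by rewrite pnatr_eq0 -lt0n.
Qed.

(** Gibbs' inequality for the kernel with weight 1/2 on the decoded message and [1/(2M)] on each
    other one; [ln 2] stands in for the binary entropy of the error. *)
Lemma fano (M : nat) (V : eqType) (W : T -> 'I_M) (Y : T -> V) (dec : V -> 'I_M) :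
  (0 < M)%N ->
  ent (fun o => (W o, Y o)) - ent Y <=
    ln 2 + #|[pred o | dec (Y o) != W o]|%:R / #|T|%:R * ln M%:R.
Proof.
move=> M0; have M0' : 0 < (M%:R : R) by rewrite ltr0n.
pose q (w : 'I_M) (v : V) : R := if w == dec v then 2^-1 else 2^-1 * M%:R^-1.
have q0 u v : 0 < q u v by rewrite /q; case: ifP => _; rewrite ?mulr_gt0 ?invr_gt0.
have q1 v : \sum_u q u v <= 1.
  rewrite (bigD1 (dec v)) //= {1}/q eqxx.
  rewrite (eq_bigr (fun=> 2^-1 * M%:R^-1)); last by move=> i /negPf; rewrite /q => ->.
  apply: (@le_trans _ _ (2^-1 + \sum_(i < M) 2^-1 * M%:R^-1)).
    rewrite lerD2l [leRHS](bigD1 (dec v)) //= lerDr mulr_ge0 ?invr_ge0 //; lra.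
  rewrite sumr_const card_ord -mulrnAr -[_ *+ M]mulr_natl divff ?gt_eqF //; lra.
apply: le_trans (ent_cond_le W Y q0 q1) _.
have [/eqP T0|] := boolP (#|T| == 0)%N.
  rewrite T0 !invr0 !mulr0 mul0r addr0 ln_ge0 //; lra.
rewrite -lt0n -(@ltr0n R) => T0.
rewrite ler_pdivrMr // mulrDl mulrAC divfK ?gt_eqF //.
rewrite (eq_bigr (fun o => ln 2 + (dec (Y o) != W o)%:R * ln M%:R)); last first.
  move=> o _; rewrite /q eq_sym; case: eqP => /= _; rewrite ?mul0r ?addr0 ?mul1r.
    by rewrite lnV ?posrE ?opprK.
  by rewrite -invfM lnV ?posrE ?mulr_gt0 // opprK lnM ?posrE.
rewrite big_split /= sumr_const -mulr_suml -[ln 2 *+ _]mulr_natr.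
by rewrite -natr_sum -big_mkcond sum1_card.
Qed.

End Entropy.

(** * Mutual information in terms of entropies *)

Section MutualInformation.
Variables (R : realType) (T TA TB : finType) (A : T -> TA) (B : T -> TB).

Lemma probE (E : pred T) : prob E = #|E|%:R / #|T|%:R :> R.
Proof.
rewrite /prob; congr (_%:R / _); apply: eq_card => x.
by apply/idP/idP; rewrite in_setE.
Qed.

(** Outcomes are grouped by the value of the pair; a pair of probability zero is an empty group and
    meets the zero branch of [mutinf]. *)
Lemma mutinf_ent :
  mutinf A B = ent R A + ent R B - ent R (fun o => (A o, B o)).
Proof.
pose P := fun o => (A o, B o).
rewrite /ent -mulrDl -mulrBl -big_split -sumrB /= mulr_suml /mutinf pair_bigA /=.
rewrite [RHS](partition_big P predT) //=; apply: eq_bigr => -[a b] _ /=.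
rewrite !probE /=.
set p := #|[pred x | (A x == a) && (B x == b)]|.
have cardP : #|[pred x | P x == (a, b)]| = p.
  by apply: eq_card => x; rewrite !inE xpair_eqE.
have [/eqP|] := boolP (p == 0)%N.
  move=> p0; rewrite p0 mul0r eqxx big_pred0 // => x; apply/negbTE.
  move: cardP; rewrite p0 => /eqP; rewrite -leqn0 leqNgt => /card_gt0P no.
  by apply/negP => Px; apply: no; exists x.
rewrite -lt0n => p0.
have [ o /andP [/eqP Ao /eqP Bo]] := card_gt0P p0.
have [T0 P0] := @card_fibre_gt0 R T _ P o; have [_ A0] := @card_fibre_gt0 R T _ A o.
have [_ B0] := @card_fibre_gt0 R T _ B o.
have eA : #|[pred x | A x == a]| = fibre A o by rewrite -Ao.
have eB : #|[pred x | B x == b]| = fibre B o by rewrite -Bo.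
have eP : p = fibre P o by rewrite -cardP -Ao -Bo.
rewrite eA eB eP gt_eqF ?divr_gt0 //.
rewrite (eq_bigr (fun=> (ln (#|T|%:R / (fibre A o)%:R) + ln (#|T|%:R / (fibre B o)%:R) -
   ln (#|T|%:R / (fibre P o)%:R)) / #|T|%:R)); last first.
  move=> x Px; have /eqP[Ax Bx] := Px.
  rewrite (@eq_fibre _ _ A x o) ?Ax ?Ao // (@eq_fibre _ _ B x o) ?Bx ?Bo //.
  by rewrite (@eq_fibre _ _ P x o) // (eqP Px) /P Ao Bo.
rewrite sumr_const cardP eP -[RHS]mulr_natl [RHS]mulrA [LHS]mulrAC; congr (_ * _ / _).
by rewrite !(lnM, lnV, ln_div) ?posrE ?(divr_gt0, invr_gt0, mulr_gt0) //; ring.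
Qed.

End MutualInformation.

(** * Converse *)

(** Discharges [determines] goals: equalities of tuples are split into components, and the known
    functional dependencies do the rest. *)
Ltac det :=
  let o := fresh "o" in let o' := fresh "o'" in let H := fresh "H" in
  move=> o o' /= H;
  repeat match goal with
    | K : (_, _) = (_, _) |- _ => injection K; clear K; intros
  end;
  repeat match goal with |- (_, _) = (_, _) => apply: f_equal2 end;
  eauto 6.

(** * Entropy inequalities from functional dependencies alone *)

Section ShannonConverse.
Variables (R : realType) (T : finType) (TW1 TW2 TU TZ TV TS TA TP TX TY1 TY2 TB : finType).
(** [U] and [Z] stand for the message and local randomness of transmitters 1 and 2, and [P] for what
    receiver 2 sees of transmitter 2 beyond the interference [S]. *)
Variables (W1 : T -> TW1) (W2 : T -> TW2) (U : T -> TU) (Z : T -> TZ) (V : T -> TV).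
Variables (S : T -> TS) (A : T -> TA) (P : T -> TP) (X : T -> TX).
Variables (Y1 : T -> TY1) (Y2 : T -> TY2).
Hypotheses (UW1 : determines U W1) (ZV : determines Z V) (ZS : determines Z S).
Hypotheses (SA : determines S A) (Y1A : determines Y1 A).
Hypothesis UVX : forall o o', U o = U o' -> V o = V o' -> X o = X o'.
Hypothesis Y1XS : forall o o', Y1 o = Y1 o' -> X o = X o' -> S o = S o'.
Hypothesis SPY2 : forall o o', S o = S o' -> P o = P o' -> Y2 o = Y2 o'.

Notation H := (ent R).
(** Independence of [U] and [Z]; the reverse inequality is subadditivity. *)
Hypothesis UZ_indep : H U + H Z <= H (fun o => (U o, Z o)).

(** Independence passes to functions: submodularity replaces first [Z] by [D], then [U] by [C]. *)
Lemma ent_indep (TC TD : eqType) (C : T -> TC) (D : T -> TD) :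
  determines U C -> determines Z D -> H C + H D <= H (fun o => (C o, D o)).
Proof.
move=> UC ZD; have e0 := UZ_indep.
have e1 : H (fun o => (U o, Z o)) + H D <= H (fun o => (U o, D o)) + H Z.
  by apply: ent_submod; det.
have e2 : H (fun o => (U o, D o)) + H C <= H U + H (fun o => (C o, D o)).
  by apply: ent_submod; det.
lra.
Qed.

(** Conditional independence of [X] and [S] given [(W1, V)]: [X] is a function of [(U, V)], and [U]
    is independent of [(S, V)]. *)
Lemma ent_cond_indep :
  H (fun o => (X o, W1 o, V o)) + H (fun o => (S o, W1 o, V o)) <=
  H (fun o => (X o, S o, W1 o, V o)) + H (fun o => (W1 o, V o)).
Proof.
have e1 : H U + H (fun o => (S o, V o)) <= H (fun o => (U o, (S o, V o))).
  by apply: ent_indep; det.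
have e2 : H (fun o => (U o, (S o, V o))) + H (fun o => (X o, W1 o, V o)) <=
          H (fun o => (X o, S o, W1 o, V o)) + H (fun o => (U o, V o)).
  by apply: ent_submod; det.
have e3 : H (fun o => (U o, V o)) <= H U + H V by apply: ent_pair_le; det.
have e4 : H (fun o => (S o, W1 o, V o)) <= H W1 + H (fun o => (S o, V o)).
  by apply: ent_pair_le; det.
have e5 : H W1 + H V <= H (fun o => (W1 o, V o)) by apply: ent_indep; det.
lra.
Qed.

Lemma ent_coop_bound :
  H (fun o => (Y2 o, V o, Y1 o, W1 o)) + H (fun o => (W1 o, A o)) <=
  2 * H (fun o => (W1 o, Y1 o)) + H V + H P.
Proof.
have e1 : H (fun o => (Y2 o, V o, Y1 o, W1 o)) <=
          H (fun o => (Y1 o, S o, W1 o, V o)) + H P by apply: ent_pair_le; det.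
(* From here to [e5]: [H(S | Y1, V, W1) <= H(S | A, V, W1) <= H(S | X, A, V, W1) <= H(Y1 | W1, A)].
   The middle step is conditional independence, the last holds because [Y1] and [X] give [S]. *)
have e2 : H (fun o => (Y1 o, S o, W1 o, V o)) + H (fun o => (W1 o, A o, V o)) <=
          H (fun o => (Y1 o, W1 o, V o)) + H (fun o => (S o, W1 o, V o)).
  by apply: ent_submod; det.
have e3 := ent_cond_indep.
have e4 : H (fun o => (X o, A o, W1 o, V o)) + H (fun o => (W1 o, V o)) <=
          H (fun o => (X o, W1 o, V o)) + H (fun o => (W1 o, A o, V o)).
  by apply: ent_submod; det.
have e5 : H (fun o => (X o, S o, W1 o, V o)) + H (fun o => (W1 o, A o)) <=
          H (fun o => (X o, A o, W1 o, V o)) + H (fun o => (W1 o, Y1 o)).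
  by apply: ent_submod; det.
have e6 : H (fun o => (Y1 o, W1 o, V o)) <= H (fun o => (W1 o, Y1 o)) + H V.
  by apply: ent_pair_le; det.
lra.
Qed.

Variables f1 f2 : R.
Hypothesis fano1 : H (fun o => (W1 o, Y1 o)) - H Y1 <= f1.
Hypothesis fano2 : H (fun o => (W2 o, Y2 o)) - H Y2 <= f2.

(** [A] comes from transmitter 2 only, so it is independent of [W1] and its entropy is lost to
    message 1. *)
Lemma rate1_bound : H W1 <= f1 + (H Y1 - H A).
Proof.
have e1 : H W1 + H A <= H (fun o => (W1 o, A o)) by apply: ent_indep; det.
have e2 : H (fun o => (W1 o, A o)) <= H (fun o => (W1 o, Y1 o)).
  by apply: ent_determines; det.
have e3 := fano1; lra.
Qed.

Let leak := H W2 + H Y1 - H (fun o => (W2 o, Y1 o)).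

(** [Y1] alone tells at most [leak] about [W2], while [Y1] and [B] together give [Y2] and hence
    nearly [W2]. *)
Lemma rate2_bound (B : T -> TB) :
  (forall o o', Y1 o = Y1 o' -> B o = B o' -> Y2 o = Y2 o') ->
  H W2 <= leak + f2 + H B.
Proof.
move=> Y1B; rewrite /leak.
have e1 : H (fun o => (W2 o, Y1 o)) + H Y2 <=
          H (fun o => (Y1 o, Y2 o)) + H (fun o => (W2 o, Y2 o)).
  by apply: ent_submod; det.
have e2 : H (fun o => (Y1 o, Y2 o)) <= H Y1 + H B by apply: ent_pair_le; det.
have e3 := fano2; lra.
Qed.

(** Fano for message 1 enters twice, once per copy of [H(W1, Y1)] in [ent_coop_bound]; of the two
    resulting [H Y1], one is absorbed by [leak]. *)
Lemma sum_rate_bound :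
  H W1 + H W2 <= leak + 2 * f1 + f2 + (H Y1 - H A) + H V + H P.
Proof.
rewrite /leak.
have e1 : H W1 + H A <= H (fun o => (W1 o, A o)) by apply: ent_indep; det.
have e2 := ent_coop_bound.
have e3 : H (fun o => (W2 o, Y1 o)) + H Y2 <=
          H (fun o => (Y2 o, V o, Y1 o, W1 o)) + H (fun o => (W2 o, Y2 o)).
  by apply: ent_submod; det.
have e4 := fano1; have e5 := fano2; lra.
Qed.

End ShannonConverse.

(** * Signal levels and the downshift matrix *)

Section Shift.
Variable q : nat.
Implicit Types (x y : 'cV['F_2]_q).

(* Coordinates indexed by [nat], with junk value [0] outside [0 <= j < q]. *)
Definition coord x (j : nat) : 'F_2 := if insub j is Some i then x i 0 else 0.

Lemma coord_ord x (i : 'I_q) : coord x i = x i 0.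
Proof. by rewrite /coord valK. Qed.

Lemma coord_ge x j : (q <= j)%N -> coord x j = 0.
Proof. by move=> qj; rewrite /coord insubN // -leqNgt. Qed.

Lemma coordD x y j : coord (x + y) j = coord x j + coord y j.
Proof. by rewrite /coord; case: insubP => [i _ _|_]; rewrite ?mxE ?addr0. Qed.

Lemma coordP x y : (forall j, (j < q)%N -> coord x j = coord y j) -> x = y.
Proof.
by move=> xy; apply/matrixP => i j; rewrite ord1 -!coord_ord xy.
Qed.

Lemma coord_col (f : nat -> 'F_2) j : (j < q)%N -> coord (\col_(i < q) f i) j = f j.
Proof. by move=> jq; rewrite /coord insubT mxE. Qed.

Lemma coord_downshift x j :
  coord (downshift q *m x) j = if (0 < j < q)%N then coord x j.-1 else 0.
Proof.
have [jq|qj] := ltnP j q; last by rewrite coord_ge // andbF.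
rewrite -[j]/(nat_of_ord (Ordinal jq)) coord_ord mxE /= andbT.
under eq_bigr do rewrite mxE /=.
case: j jq => [|j] jq /=; first by rewrite big1 // => i _; rewrite mul0r.
have jq' : (j < q)%N by apply: ltnW.
rewrite (bigD1 (Ordinal jq')) //= eqxx mul1r big1 ?addr0 => [|i]; last first.
  by rewrite eqSS -val_eqE /= eq_sym => /negPf ->; rewrite mul0r.
by rewrite -[j in RHS]/(nat_of_ord (Ordinal jq')) coord_ord.
Qed.

Lemma coord_shift x k j :
  coord (mxpow (downshift q) k *m x) j = if (k <= j < q)%N then coord x (j - k) else 0.
Proof.
elim: k j => [|k IH] j.
  by rewrite mul1mx subn0 /=; case: ltnP => // /coord_ge ->.
rewrite [mxpow _ _]/= -mulmxA coord_downshift IH.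
case: j => [|j] //=; rewrite ltnS subSS.
have [jq|qj] := ltnP j.+1 q; last by rewrite andbF.
by rewrite (ltnW jq) !andbT.
Qed.

End Shift.

(** * Entropies of coordinates of a uniform product space *)

Section Uniform.
Variables (R : realType) (T : finType).
Hypothesis T_gt0 : (0 < #|T|)%N.

Lemma ent_full (U : eqType) (X : T -> U) : injective X -> ent R X = ln #|T|%:R.
Proof.
move=> Xinj; rewrite /ent (eq_bigr (fun=> ln #|T|%:R)); last first.
  move=> o _; rewrite (_ : fibre X o = 1%N) ?divr1 //.
  by rewrite /fibre -(card1 o); apply: eq_card => x; rewrite !inE inj_eq.
by rewrite sumr_const -[X in X / _]mulr_natr mulfK // pnatr_eq0 -lt0n.
Qed.

(** The pair has entropy [ln #|U| + ln #|V|], and neither component can exceed its share, so both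
    attain it. *)
Lemma ent_split (U V : finType) (X : T -> U) (Y : T -> V) :
  injective (fun o => (X o, Y o)) -> #|T| = (#|U| * #|V|)%N ->
  ent R X = ln #|U|%:R /\ ent R Y = ln #|V|%:R.
Proof.
move=> XY card; have e0 := ent_full XY.
have e1 : ent R (fun o => (X o, Y o)) <= ent R X + ent R Y by apply: ent_pair_le.
have e2 := @ent_le_ln_card R _ _ X; have e3 := @ent_le_ln_card R _ _ Y.
have := T_gt0; rewrite card muln_gt0 => /andP[U0 V0].
move: e0; rewrite card natrM lnM ?posrE ?ltr0n // => e0.
by split; lra.
Qed.

End Uniform.

(** * The converse inequalities for an arbitrary code *)

Section CodeConverse.
Variables (R : realType) (m n C N M1 M2 : nat) (c : Defs.code m n C N M1 M2).
Hypotheses (M1_gt0 : (0 < M1)%N) (M2_gt0 : (0 < M2)%N).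
Notation q := (qdim m n).
Notation H := (@ent R (omega c) _).

Let S (o : omega c) : {ffun 'I_N -> 'cV['F_2]_q} :=
  [ffun t => mxpow (downshift q) (q - n) *m x2seq o t].
Let X (o : omega c) : {ffun 'I_N -> 'cV['F_2]_q} :=
  [ffun t => mxpow (downshift q) (q - m) *m x1seq o t].
Let rows (k a : nat) (x : 'I_N -> 'cV['F_2]_q) : {ffun 'I_N -> {ffun 'I_k -> 'F_2}} :=
  [ffun t => [ffun i : 'I_k => coord (x t) (i + a)]].
Let Y1 (o : omega c) := y1of o.
Let Y2 (o : omega c) := y2of o.
(* The top [n - m] levels of receiver 1, which transmitter 1 cannot reach. *)
Let A (o : omega c) := rows (n - m) 0 (Y1 o).
(* The levels of transmitter 2 seen by receiver 2 but not by receiver 1. *)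
Let P (o : omega c) := rows (m - n) n (x2seq o).
(** What receiver 1 still lacks to know [Y2]: the levels seen by receiver 2 below the top [n - m],
    which reach receiver 1 undisturbed. *)
Let B (o : omega c) := rows (m - (n - m)) (n - m) (x2seq o).
Let V (o : omega c) : {ffun 'I_N -> C.-tuple bool} := [ffun t => coop c o.1.1.2 o.2 t].
Let U (o : omega c) := (o.1.1.1, o.1.2).
Let Z (o : omega c) := (o.1.1.2, o.2).

Lemma rowsE k a x t i : rows k a x t i = coord (x t) (i + a).
Proof. by rewrite !ffunE. Qed.

Lemma rowsP k a x x' j t : rows k a x = rows k a x' -> (a <= j < k + a)%N ->
  coord (x t) j = coord (x' t) j.
Proof.
move=> /ffunP /(_ t); rewrite !ffunE => /ffunP e /andP[aj jk].
have jk' : (j - a < k)%N by lia.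
by have := e (Ordinal jk'); rewrite !ffunE /= subnK.
Qed.

Lemma Y1_XS o t : Y1 o t = X o t + S o t.
Proof. by rewrite !ffunE. Qed.

Lemma coord_S o t j : (q - n <= j < q)%N -> coord (S o t) j = coord (x2seq o t) (j - (q - n)).
Proof. by move=> jq; rewrite ffunE coord_shift jq. Qed.

Lemma coord_Y1 o t j : (j < n - m)%N -> coord (Y1 o t) j = coord (S o t) j.
Proof.
move=> jnm; rewrite Y1_XS coordD ffunE coord_shift leqNgt.
by rewrite (_ : (j < q - m)%N) ?add0r //; rewrite /qdim; lia.
Qed.

Lemma coord_Y2 o t j :
  coord (Y2 o t) j = if (q - m <= j < q)%N then coord (x2seq o t) (j - (q - m)) else 0.
Proof. by rewrite ffunE coord_shift. Qed.

Lemma Y2_ext o o' :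
  (forall t j, (j < m)%N -> coord (x2seq o t) j = coord (x2seq o' t) j) -> Y2 o = Y2 o'.
Proof.
move=> e; apply/ffunP => t; apply: coordP => j jq; rewrite !coord_Y2.
by case: ifP => // jm; rewrite e //; move: jq jm; rewrite /qdim; lia.
Qed.

Lemma S_x2 o o' t j : S o = S o' -> (j < n)%N -> coord (x2seq o t) j = coord (x2seq o' t) j.
Proof.
move=> SS jn; have jq : (q - n <= j + (q - n) < q)%N by rewrite /qdim; lia.
by have := coord_S o t jq; rewrite SS (coord_S o' t jq) addnK.
Qed.

Lemma det_S_A : determines S A.
Proof.
move=> o o' SS; apply/ffunP => t; apply/ffunP => i; rewrite !rowsE addn0.
by rewrite !coord_Y1 // SS.
Qed.

Lemma det_Y1_A : determines Y1 A.
Proof. by move=> o o' YY; rewrite /A YY. Qed.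

Lemma det_UV_X o o' : U o = U o' -> V o = V o' -> X o = X o'.
Proof.
move=> [e1 e2] /ffunP eV; apply/ffunP => t; rewrite !ffunE /x1seq e1 e2.
by congr (_ *m _); apply: enc1_causal => s _; have := eV s; rewrite !ffunE.
Qed.

Lemma det_Y1X_S o o' : Y1 o = Y1 o' -> X o = X o' -> S o = S o'.
Proof.
move=> /ffunP e1 e2; apply/ffunP => t; have := e1 t.
by rewrite !Y1_XS e2 => /addrI.
Qed.

Lemma det_SP_Y2 o o' : S o = S o' -> P o = P o' -> Y2 o = Y2 o'.
Proof.
move=> SS PP; apply: Y2_ext => t j jm.
have [jn|nj] := ltnP j n; first exact: S_x2.
by apply: (rowsP t PP); lia.
Qed.

Lemma det_Y1B_Y2 o o' : Y1 o = Y1 o' -> B o = B o' -> Y2 o = Y2 o'.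
Proof.
move=> YY BB; apply: Y2_ext => t j jm.
have [jn|nj] := ltnP j (n - m)%N; last by apply: (rowsP t BB); lia.
have := coord_Y1 o t jn; rewrite YY coord_Y1 //.
rewrite !coord_S; try by rewrite /qdim; lia.
by rewrite (_ : (j - _)%N = j) //; rewrite /qdim; lia.
Qed.

Lemma ent_rows_le k (F : omega c -> {ffun 'I_N -> {ffun 'I_k -> 'F_2}}) :
  H F <= N%:R * k%:R * ln 2.
Proof.
apply: le_trans (ent_le_ln_card R F) _.
rewrite !card_ffun card_Fp // !card_ord -expnM natrX lnXn ?ltr0n //.
by rewrite -[leLHS]mulr_natl natrM [k%:R * _]mulrC.
Qed.

Lemma ent_V_le : H V <= N%:R * C%:R * ln 2.
Proof.
apply: le_trans (ent_le_ln_card R V) _.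
rewrite !card_ffun !card_ord card_tuple card_bool -expnM natrX lnXn ?ltr0n //.
by rewrite -[leLHS]mulr_natl natrM [C%:R * _]mulrC.
Qed.

(** Outside [A], receiver 1 has exactly [m] levels. *)
Lemma ent_Y1_A : H Y1 - H A <= N%:R * m%:R * ln 2.
Proof.
pose L o := rows m (n - m) (Y1 o).
have e1 : H Y1 <= H A + H L.
  apply: ent_pair_le => o o' /= [e1 e2]; apply/ffunP => t; apply: coordP => j jq.
  have [jn|nj] := ltnP j (n - m)%N.
    by apply: (rowsP t e1); rewrite addn0.
  by apply: (rowsP t e2); move: jq; rewrite /qdim; lia.
have := @ent_rows_le _ L; lra.
Qed.

Lemma card_omega_gt0 : (0 < #|omega c|)%N.
Proof.
by rewrite !card_prod !card_tuple !card_ord card_bool !muln_gt0 !expn_gt0 M1_gt0 M2_gt0.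
Qed.

Lemma ent_W1 : H (@W1of _ _ _ _ _ _ c) = ln M1%:R.
Proof.
have [||->] := @ent_split R _ card_omega_gt0 _ _ (@W1of _ _ _ _ _ _ c)
  (fun o => (o.1.1.2, o.1.2, o.2)).
- by move=> [[[? ?] ?] ?] [[[? ?] ?] ?]; rewrite /W1of /W2of => -[] -> -> -> ->.
- by rewrite !card_prod; lia.
- by rewrite card_ord.
Qed.

Lemma ent_W2 : H (@W2of _ _ _ _ _ _ c) = ln M2%:R.
Proof.
have [||->] := @ent_split R _ card_omega_gt0 _ _ (@W2of _ _ _ _ _ _ c)
  (fun o => (o.1.1.1, o.1.2, o.2)).
- by move=> [[[? ?] ?] ?] [[[? ?] ?] ?]; rewrite /W1of /W2of => -[] -> -> -> ->.
- by rewrite !card_prod; lia.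
- by rewrite card_ord.
Qed.

Lemma UZ_independent : H U + H Z <= H (fun o => (U o, Z o)).
Proof.
have UZinj : injective (fun o : omega c => (U o, Z o)).
  by move=> [[[? ?] ?] ?] [[[? ?] ?] ?] [] /= -> -> -> ->.
have UZcard : #|omega c| =
    (#|{: 'I_M1 * (k1 c).-tuple bool}| * #|{: 'I_M2 * (k2 c).-tuple bool}|)%N.
  by rewrite !card_prod; lia.
have [-> ->] := ent_split R card_omega_gt0 UZinj UZcard.
rewrite (ent_full R card_omega_gt0 UZinj) UZcard natrM lnM //.
  by rewrite posrE ltr0n card_prod card_tuple card_ord card_bool muln_gt0 expn_gt0 M1_gt0.
by rewrite posrE ltr0n card_prod card_tuple card_ord card_bool muln_gt0 expn_gt0 M2_gt0.
Qed.

Notation pe := (Perr (R := R) c).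

Lemma code_fano (M : nat) (W : omega c -> 'I_M) (Y : omega c -> {ffun 'I_N -> 'cV['F_2]_q})
    (dec : {ffun 'I_N -> 'cV['F_2]_q} -> 'I_M) : (0 < M)%N ->
  (forall o, dec (Y o) != W o ->
     (dec1 c (y1of o) != W1of o) || (dec2 c (y2of o) != W2of o)) ->
  H (fun o => (W o, Y o)) - H Y <= ln 2 + pe * ln M%:R.
Proof.
move=> M0 err; apply: le_trans (fano R W Y dec M0) _.
rewrite lerD2l ler_wpM2r ?ln_ge0 ?ler1n // /Perr probE ler_wpM2r ?invr_ge0 ?ler0n //.
by rewrite ler_nat; apply/subset_leq_card/fintype.subsetP => o; rewrite !inE; exact: err.
Qed.

Lemma converse_bounds :
  [/\ ln M1%:R <= ln 2 + pe * ln M1%:R + N%:R * m%:R * ln 2,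
      ln M2%:R <= leak2 (R := R) c + (ln 2 + pe * ln M2%:R)
                  + N%:R * (m - (n - m))%:R * ln 2 &
      ln M1%:R + ln M2%:R <= leak2 (R := R) c + 2 * (ln 2 + pe * ln M1%:R)
         + (ln 2 + pe * ln M2%:R) + N%:R * m%:R * ln 2 + N%:R * C%:R * ln 2
         + N%:R * (m - n)%:R * ln 2].
Proof.
have f1 : H (fun o => (@W1of _ _ _ _ _ _ c o, Y1 o)) - H Y1 <= ln 2 + pe * ln M1%:R.
  by apply: (@code_fano _ _ _ (dec1 c)) => // o ->.
have f2 : H (fun o => (@W2of _ _ _ _ _ _ c o, Y2 o)) - H Y2 <= ln 2 + pe * ln M2%:R.
  by apply: (@code_fano _ _ _ (dec2 c)) => // o ->; rewrite orbT.
have UW1 : determines U (@W1of _ _ _ _ _ _ c) by move=> o o' [].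
have ZV : determines Z V.
  by move=> o o' [e1 e2]; apply/ffunP => t; rewrite !ffunE e1 e2.
have ZS : determines Z S.
  by move=> o o' [e1 e2]; apply/ffunP => t; rewrite !ffunE /x2seq e1 e2.
have b1 := rate1_bound UW1 ZS det_S_A det_Y1_A UZ_independent f1.
have b2 := rate2_bound f2 det_Y1B_Y2.
have b3 := sum_rate_bound UW1 ZV ZS det_S_A det_Y1_A det_UV_X
  det_Y1X_S det_SP_Y2 UZ_independent f1 f2.
move: b1 b2 b3; rewrite /leak2 mutinf_ent ent_W1 ent_W2 -/Y1 => b1 b2 b3.
have e1 := ent_Y1_A; have e2 := ent_V_le; have e3 := @ent_rows_le _ P.
have e4 := @ent_rows_le _ B.
by split; lra.
Qed.

End CodeConverse.

(** * A perfectly secret scheme *)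

(** [F] and [G] are coordinates of the uniform space as a product, hence independent, and so are
    functions of them. *)
Lemma mutinf_indep (R : realType) (T TF TG TA TB : finType)
    (F : T -> TF) (G : T -> TG) (A : T -> TA) (B : T -> TB) :
  (0 < #|T|)%N -> injective (fun o => (F o, G o)) -> #|T| = (#|TF| * #|TG|)%N ->
  determines F A -> determines G B -> mutinf A B = 0 :> R.
Proof.
move=> T0 FG card FA GB; have [eF eG] := ent_split R T0 FG card.
have FG_indep : ent R F + ent R G <= ent R (fun o => (F o, G o)).
  have := T0; rewrite card muln_gt0 => /andP[F0 G0].
  by rewrite eF eG (ent_full R T0 FG) card natrM lnM ?posrE ?ltr0n.
have e1 := ent_indep FG_indep FA GB.
have e2 : ent R (fun o => (A o, B o)) <= ent R A + ent R B by apply: ent_pair_le.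
by rewrite mutinf_ent; apply/eqP; rewrite subr_eq0 eq_le e1 e2.
Qed.

(* Nothing sent by transmitter 1 reaches receiver 2. *)
Lemma leak1_eq0 (R : realType) m n C N M1 M2 (c : Defs.code m n C N M1 M2) :
  (0 < M1)%N -> (0 < M2)%N -> leak1 (R := R) c = 0.
Proof.
move=> M1_gt0 M2_gt0.
apply: (@mutinf_indep _ _ _ _ _ _ (fun o : omega c => o.1.1.1)
          (fun o : omega c => (o.1.1.2, o.1.2, o.2))).
- exact: card_omega_gt0.
- by move=> [[[? ?] ?] ?] [[[? ?] ?] ?] [] /= -> -> -> ->.
- by rewrite !card_prod; lia.
- by move=> o o'.
- by move=> o o' [e1 _ e2]; apply/ffunP => t; rewrite !ffunE /x2seq e1 e2.
Qed.

Lemma F2_addb (a b : bool) : (a (+) b)%:R = a%:R + b%:R :> 'F_2.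
Proof. by apply/val_inj; case: a b => [] []. Qed.

Lemma F2_neq0 (b : bool) : (b%:R != 0 :> 'F_2) = b.
Proof. by case: b. Qed.

(** * Coding by cancellation and jamming *)

Section Scheme.
Variables (m n C N M1 M2 : nat).
Notation q := (qdim m n).
(* Number of interfering levels that the cooperative link can cancel. *)
Let c0 := minn C (minn m n - (n - m)).
Variables (w01 : 'I_M1) (w02 : 'I_M2).
(* [E1 w t i]: data bit of transmitter 1 aimed at level [i] of receiver 1.
   [E2 w t j]: bit sent by transmitter 2 on its level [j].
   [J t j]: transmitter 1 jams the level of receiver 1 hit by level [j] of transmitter 2. *)
Variables (E1 : 'I_M1 -> nat -> nat -> bool) (E2 : 'I_M2 -> nat -> nat -> bool).
Variable J : nat -> nat -> bool.
(** [J] moved to the levels of receiver 1: level [j] of transmitter 2 lands on level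
    [j + (q - n)]. *)
Let jam t i := (q - n <= i)%N && J t (i - (q - n)).

Hypothesis J_range : forall t j, J t j -> (n - m + c0 <= j)%N.
Hypothesis E1_range : forall w t i, E1 w t i -> (q - m <= i)%N && ~~ jam t i.
(** Slot 0 stays silent because no cooperation bit has arrived yet, the top [n - m] levels because
    they lie open to receiver 1; an interfering level beyond the [c0] cancelled ones is used only
    under jamming. *)
Hypothesis E2_range : forall w t j, E2 w t j ->
  [/\ (0 < t)%N, (n - m <= j < m)%N & (n - m + c0 <= j < n)%N -> J t j].
Hypothesis E1_inj : forall w w',
  (forall t i, (t < N)%N -> (i < q)%N -> E1 w t i = E1 w' t i) -> w = w'.
Hypothesis E2_inj : forall w w',
  (forall t i, (t < N)%N -> (i < q)%N -> E2 w t i = E2 w' t i) -> w = w'.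

Lemma pred_ord_subproof (t : 'I_N) : (t.-1 < N)%N.
Proof. exact: leq_ltn_trans (leq_pred t) (ltn_ord t). Qed.
Let pred_ord (t : 'I_N) := Ordinal (pred_ord_subproof t).

Let lo := (n - m + (q - n))%N.

Definition noise (r : (N * q).-tuple bool) (t i : nat) := nth false r (t * q + i).

(** Adding the interfering bit a second time removes it over [F_2]. The bit was received in the
    previous slot; [0 < t] is needed because [pred_ord] fixes slot 0. *)
Definition cancel_bit (v : 'I_N -> C.-tuple bool) (t : 'I_N) (i : nat) :=
  [&& (0 < t)%N, (lo <= i < lo + c0)%N & nth false (v (pred_ord t)) (i - lo)].

Definition scheme_enc1 (w : 'I_M1) (r : (N * q).-tuple bool) (v : 'I_N -> C.-tuple bool)
    (t : 'I_N) : 'cV['F_2]_q :=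
  \col_(l < q) (E1 w t (l + (q - m)) (+) cancel_bit v t (l + (q - m))
    (+) (jam t (l + (q - m)) && noise r t (l + (q - m))))%:R.

Definition scheme_enc2 (w : 'I_M2) (r : 0.-tuple bool) (t : 'I_N) : 'cV['F_2]_q :=
  \col_(j < q) (E2 w t j)%:R.

Definition scheme_coop (w : 'I_M2) (r : 0.-tuple bool) (t : 'I_N) : C.-tuple bool :=
  [tuple E2 w t.+1 (n - m + i) | i < C].

Lemma scheme_causal w r v v' (t : 'I_N) :
  (forall s : 'I_N, (s < t)%N -> v s = v' s) -> scheme_enc1 w r v t = scheme_enc1 w r v' t.
Proof.
move=> vv'; apply/matrixP => l j; rewrite !mxE /cancel_bit.
have [t0|//] := ltnP 0 t.
by rewrite vv' //= prednK.
Qed.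

Definition scheme_dec1 (y : {ffun 'I_N -> 'cV['F_2]_q}) : 'I_M1 :=
  odflt w01 [pick w | [forall t : 'I_N, forall i : 'I_q,
    E1 w t i == [&& (q - m <= i)%N, ~~ jam t i & coord (y t) i != 0]]].

Definition scheme_dec2 (y : {ffun 'I_N -> 'cV['F_2]_q}) : 'I_M2 :=
  odflt w02 [pick w | [forall t : 'I_N, forall j : 'I_q,
    E2 w t j == (j < m)%N && (coord (y t) (j + (q - m)) != 0)]].

Definition scheme : Defs.code m n C N M1 M2 :=
  @Code m n C N M1 M2 (N * q) 0 scheme_enc2 scheme_coop scheme_enc1 scheme_causal
    scheme_dec1 scheme_dec2.

Implicit Type o : omega scheme.

(* The jamming noise acts as a one-time pad on the bits of transmitter 2. *)
Definition padded (o : omega scheme) : (N * q).-tuple bool :=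
  [tuple nth false o.1.2 k (+)
     (jam (k %/ q) (k %% q) && E2 o.1.1.2 (k %/ q) (k %% q - (q - n))) | k < N * q].

Lemma coord_x2 o t j : (j < q)%N -> coord (x2seq o t) j = (E2 o.1.1.2 t j)%:R.
Proof. by move=> jq; rewrite (@coord_col q (fun j => (E2 o.1.1.2 t j)%:R)). Qed.

Lemma coord_x1 o t l : (l < q)%N -> coord (x1seq o t) l =
  (E1 o.1.1.1 t (l + (q - m)) (+) cancel_bit (coop scheme o.1.1.2 o.2) t (l + (q - m))
    (+) (jam t (l + (q - m)) && noise o.1.2 t (l + (q - m))))%:R.
Proof.
move=> lq; rewrite (@coord_col q (fun l => (E1 o.1.1.1 t (l + (q - m)) (+)
  cancel_bit (coop scheme o.1.1.2 o.2) t (l + (q - m))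
    (+) (jam t (l + (q - m)) && noise o.1.2 t (l + (q - m))))%:R)) //.
Qed.

(** The crux of secrecy: receiver 1 depends on message 2 only through the pad [padded]. *)
Lemma coord_y1 o (t : 'I_N) i : (i < q)%N ->
  coord (y1of o t) i =
  ((q - m <= i)%N && (E1 o.1.1.1 t i (+) (jam t i && noise (padded o) t i)))%:R.
Proof.
move=> iq; rewrite ffunE /out1 coordD !coord_shift iq !andbT.
have -> : coord (x2seq o t) (i - (q - n)) = (E2 o.1.1.2 t (i - (q - n)))%:R.
  exact: coord_x2 (leq_ltn_trans (leq_subr _ _) iq).
have -> : coord (x1seq o t) (i - (q - m)) =
   if (q - m <= i)%N then (E1 o.1.1.1 t i (+) cancel_bit (coop scheme o.1.1.2 o.2) t i
    (+) (jam t i && noise o.1.2 t i))%:R else coord (x1seq o t) (i - (q - m)).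
  case: ifP => // qmi; rewrite coord_x1 ?subnK //.
  exact: leq_ltn_trans (leq_subr _ _) iq.
have -> : cancel_bit (coop scheme o.1.1.2 o.2) t i =
   [&& (0 < t)%N, (lo <= i < lo + c0)%N & E2 o.1.1.2 t (i - (q - n))].
  rewrite /cancel_bit; case: ltnP => //= t0; case: (boolP (lo <= i < lo + c0)%N) => //= ilo.
  have iC : (i - lo < C)%N by move: ilo; rewrite /c0; lia.
  rewrite (nth_map (Ordinal iC)) ?size_enum_ord // nth_enum_ord //.
  by rewrite prednK //; congr E2; move: ilo; rewrite /lo; lia.
have -> : noise (padded o) t i = noise o.1.2 t i (+) (jam t i && E2 o.1.1.2 t (i - (q - n))).
  have kq : (t * q + i < N * q)%N.
    by apply: (@leq_trans (t.+1 * q)); rewrite ?leq_mul2r ?ltn_ord ?orbT // mulSn; lia.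
  rewrite {1}/noise /= (nth_map (Ordinal kq)) ?size_enum_ord // nth_enum_ord //.
  have q0 : (0 < q)%N by lia.
  by rewrite divnMDl // divn_small // addn0 modnMDl modn_small.
have [qni|qni] := leqP (q - n) i; last first.
  have -> : (lo <= i < lo + c0)%N = false by rewrite /lo; lia.
  have -> : jam t i = false by rewrite /jam; lia.
  by rewrite addr0 andbF !addbF; case: ifP => //= ->.
have e2 := @E2_range o.1.1.2 t (i - (q - n)).
(* Levels out of reach of transmitter 1 face the top [n - m] levels of transmitter 2, which carry no
   data. *)
have [qmi|qmi] := leqP (q - m) i; last first.
  rewrite add0r; case: E2 e2 => // /(_ isT)[_]; move: qmi; rewrite /qdim; lia.
rewrite -F2_addb /=; congr (_%:R); rewrite -addbA -addbA; congr (_ (+) _).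
case eE2 : (E2 _ _ _) e2; last by move=> _; rewrite !andbF !addbF.
move=> /(_ isT)[-> jm Jt] /=; rewrite andbT.
have jn : (i - (q - n) < n)%N by move: iq qni; rewrite /qdim; lia.
(* Interference is cancelled in the first [c0] of the remaining levels and merged into the noise in
   the others. *)
have [ic|ic] := ltnP (i - (q - n)) (n - m + c0).
  have -> : jam t i = false by apply/negP => /andP[_ /J_range]; lia.
  by have -> : (lo <= i < lo + c0)%N by rewrite /lo; lia.
have -> : jam t i by rewrite /jam qni Jt // ic.
have -> : (lo <= i < lo + c0)%N = false by rewrite /lo; lia.
by rewrite /= addbC.
Qed.

Lemma coord_y2 o (t : 'I_N) j : (j < m)%N ->
  coord (y2of o t) (j + (q - m)) = (E2 o.1.1.2 t j)%:R.
Proof.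
move=> jm; rewrite ffunE coord_shift.
have -> : (q - m <= j + (q - m) < q)%N by move: jm; rewrite /qdim; lia.
by rewrite addnK coord_x2 // (leq_trans jm) // leq_maxl.
Qed.

Lemma E1_y1 o (t : 'I_N) (i : 'I_q) :
  E1 o.1.1.1 t i = [&& (q - m <= i)%N, ~~ jam t i & coord (y1of o t) i != 0].
Proof.
rewrite coord_y1 // F2_neq0; have := @E1_range o.1.1.1 t i.
by case: (E1 _ _ _) => [/(_ isT)/andP[-> /negPf ->]|_] //=;
  case: (q - m <= i)%N; case: (jam t i).
Qed.

Lemma E2_y2 o (t : 'I_N) (j : 'I_q) :
  E2 o.1.1.2 t j = (j < m)%N && (coord (y2of o t) (j + (q - m)) != 0).
Proof.
have [jm|mj] := ltnP j m; first by rewrite coord_y2 // F2_neq0.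
by apply/negP => /E2_range[_]; lia.
Qed.

Lemma scheme_dec1P o : scheme_dec1 (y1of o) = o.1.1.1.
Proof.
rewrite /scheme_dec1; case: pickP => [w /forallP wP|/(_ o.1.1.1)/negP[]]; last first.
  by apply/forallP => t; apply/forallP => i; rewrite -E1_y1.
apply: E1_inj => t i tN iq; have /forallP/(_ (Ordinal iq))/eqP := wP (Ordinal tN).
by rewrite -E1_y1.
Qed.

Lemma scheme_dec2P o : scheme_dec2 (y2of o) = o.1.1.2.
Proof.
rewrite /scheme_dec2; case: pickP => [w /forallP wP|/(_ o.1.1.2)/negP[]]; last first.
  by apply/forallP => t; apply/forallP => i; rewrite -E2_y2.
apply: E2_inj => t i tN iq; have /forallP/(_ (Ordinal iq))/eqP := wP (Ordinal tN).
by rewrite -E2_y2.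
Qed.

Lemma scheme_Perr (R : realType) : Perr (R := R) scheme = 0.
Proof.
rewrite /Perr probE (eq_card0 (A := _)) ?mul0r // => o; rewrite !inE.
by rewrite /= scheme_dec1P scheme_dec2P /W1of /W2of !eqxx.
Qed.

(** For each fixed message 2, passing from the noise to [padded] is a bijection, so [padded] is
    independent of that message. *)
Lemma scheme_leak2 (R : realType) : leak2 (R := R) scheme = 0.
Proof.
have M1_gt0 : (0 < M1)%N by case: w01 => i; lia.
have M2_gt0 : (0 < M2)%N by case: w02 => i; lia.
apply: (@mutinf_indep _ _ _ _ _ _ (fun o : omega scheme => o.1.1.2)
          (fun o : omega scheme => (o.1.1.1, padded o, o.2))).
- exact: card_omega_gt0.
- move=> o o' e; have rr' : padded o = padded o' := congr1 (fun u => u.2.1.2) e.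
  case: o o' e rr' => [[[w1 w2] r] r2] [[[w1' w2'] r'] r2'] [-> -> _ ->] rr'.
  suff -> : r = r' by [].
  apply: eq_from_tnth => k; have := congr1 (fun s => tnth s k) rr'.
  by rewrite !tnth_mktuple => /addIb; rewrite -!tnth_nth.
- by rewrite !card_prod !card_tuple /=; lia.
- by move=> o o'.
- move=> o o' e; have e1 : o.1.1.1 = o'.1.1.1 := congr1 (fun u => u.1.1) e.
  have e2 : padded o = padded o' := congr1 (fun u => u.1.2) e.
  apply/ffunP => t; apply: coordP => i iq.
  by rewrite !coord_y1 // e1 /noise e2.
Qed.

End Scheme.

Lemma card_ord_itv_ge q a k : (a + k <= q)%N ->
  (k <= #|[set j : 'I_q | (a <= j < a + k)%N]|)%N.
Proof.
move=> akq; have lt_q (i : 'I_k) : (a + i < q)%N by have := ltn_ord i; lia.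
pose f (i : 'I_k) : 'I_q := Ordinal (lt_q i).
have f_inj : injective f by move=> i j /(congr1 val) /= /addnI /val_inj.
rewrite -[leqLHS]card_ord -(card_imset _ f_inj); apply: subset_leq_card.
by apply/fintype.subsetP => _ /imsetP[i _ ->]; rewrite inE /= leq_addr ltn_add2l ltn_ord.
Qed.

(** A message is encoded as the set of positions of [D] carrying bit 1. *)
Lemma subset_labels (P : finType) (D : {set P}) M : (M <= 2 ^ #|D|)%N ->
  exists2 f : 'I_M -> {set P}, injective f & forall w, f w \subset D.
Proof.
rewrite -card_powerset => MD.
exists (fun w => enum_val (widen_ord MD w)); last first.
  by move=> w; rewrite -powersetE; apply: enum_valP.
by move=> w w' /enum_val_inj /(congr1 val) /= /val_inj.
Qed.

Lemma subset_card (P : finType) (D : {set P}) k : (k <= #|D|)%N ->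
  exists2 A : {set P}, A \subset D & #|A| = k.
Proof.
move=> /card_geqP[s [us <- sD]]; exists [set x in s].
  by apply/fintype.subsetP => x; rewrite inE => /sD.
by rewrite -(card_uniqP us); apply: eq_card => x; rewrite inE.
Qed.

(** * Allocation of positions to data and jamming *)

Section SchemeExists.
Variables (m n C N : nat).
Notation q := (qdim m n).
Notation pos := ('I_N * 'I_q)%type.
Let s := (minn m n - (n - m))%N.
Let c0 := minn C s.

Definition mem_pos (A : {set pos}) (t j : nat) :=
  [exists x in A, (x.1 == t :> nat) && (x.2 == j :> nat)].

Lemma mem_posP (A : {set pos}) t j :
  reflect (exists2 x, x \in A & x.1 = t :> nat /\ x.2 = j :> nat) (mem_pos A t j).
Proof.
apply: (iffP exists_inP) => -[x xA]; first by move=> /andP[/eqP <- /eqP <-]; exists x.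
by move=> [<- <-]; exists x; rewrite // !eqxx.
Qed.

Lemma mem_posE (A : {set pos}) (x : pos) : mem_pos A x.1 x.2 = (x \in A).
Proof.
apply/mem_posP/idP => [[y yA [e1 e2]]|xA]; last by exists x.
by rewrite (_ : x = y) //; case: x y {yA} e1 e2 => [a b] [a' b'] /= /val_inj -> /val_inj ->.
Qed.

Lemma mem_pos_inj (A B : {set pos}) :
  (forall t j, (t < N)%N -> (j < q)%N -> mem_pos A t j = mem_pos B t j) -> A = B.
Proof. by move=> AB; apply/setP => x; rewrite -!mem_posE AB. Qed.

(** [k] counts jammed positions: each moves one bit of capacity from transmitter 1 to transmitter 2.
    The factor [N.-1] reflects the silent slot 0. *)
Lemma scheme_exists (R : realType) M1 M2 k : (0 < M1)%N -> (0 < M2)%N ->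
  (k <= N.-1 * (s - c0))%N -> (M1 <= 2 ^ (N * m - k))%N ->
  (M2 <= 2 ^ (N.-1 * (m - n + c0) + k))%N ->
  exists c : Defs.code m n C N M1 M2,
    [/\ Perr (R := R) c = 0, leak1 (R := R) c = 0 & leak2 (R := R) c = 0].
Proof.
move=> M1_gt0 M2_gt0 k_le M1_le M2_le.
pose Tpos := [set t : 'I_N | (1 <= t < 1 + N.-1)%N].
have Tpos_card : (N.-1 <= #|Tpos|)%N.
  have [N0|N0] := posnP N; first by rewrite [X in X.-1]N0.
  by apply: card_ord_itv_ge; lia.
pose lv (a b : nat) := [set j : 'I_q | (a <= j < a + b)%N].
have [|J Jsub Jcard] := @subset_card _ (finset.setX Tpos (lv (n - m + c0)%N (s - c0)%N)) k.
  apply: leq_trans k_le _; rewrite cardsX leq_mul //.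
  by apply: card_ord_itv_ge; rewrite /c0 /s /qdim; lia.
have J_range t j : mem_pos J t j -> [/\ (0 < t)%N, (n - m + c0 <= j)%N & (j < minn m n)%N].
  move=> /mem_posP[x /(fintype.subsetP Jsub)]; rewrite !inE => H [<- <-].
  by move: H; rewrite /c0 /s => H; split; lia.
pose jam t i := (q - n <= i)%N && mem_pos J t (i - (q - n)).
pose Rows := finset.setX [set: 'I_N] (lv (q - m)%N m).
pose Jam := [set x in Rows | jam x.1 x.2].
pose D1 := Rows :\: Jam.
(* Cancelled levels, levels shifted out of receiver 1, and jammed positions. *)
pose D2 := finset.setX Tpos (lv (n - m)%N c0 :|: lv n (m - n)%N) :|: J.
have D1_card : (N * m - k <= #|D1|)%N.
  rewrite cardsD leq_sub //.
    rewrite cardsX cardsT card_ord leq_mul //; apply: card_ord_itv_ge.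
    by rewrite /qdim; lia.
  rewrite -Jcard; have lt_q (i : 'I_q) : (i - (q - n) < q)%N.
    exact: leq_ltn_trans (leq_subr _ _) (ltn_ord i).
  (* Each jammed row is hit by its own position of [J], so at most [k] rows are lost. *)
  pose f (x : pos) : pos := (x.1, Ordinal (lt_q x.2)).
  have f_inj : {in Rows :&: Jam &, injective f}.
    move=> [a i] [b j]; rewrite !inE /jam /=.
    move=> /and3P[_ _ /andP[ai _]] /and3P[_ _ /andP[bj _]].
    by case=> -> e; congr (_, _); apply: val_inj => /=; lia.
  rewrite -(card_in_imset f_inj); apply: subset_leq_card.
  apply/fintype.subsetP => _ /imsetP[x xRJ ->]; move: xRJ.
  by rewrite !inE => /and3P[_ _ /andP[_]]; rewrite -(mem_posE J (f x)).
have D2_card : (N.-1 * (m - n + c0) + k <= #|D2|)%N.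
  rewrite cardsU (_ : _ :&: _ = finset.set0) ?cards0 ?subn0 ?Jcard; last first.
    apply/setP => x; rewrite finset.in_setI [RHS]inE andbC; apply/negP.
    by move=> /andP[/(fintype.subsetP Jsub)]; rewrite !inE /c0 /s; lia.
  rewrite leq_add2r cardsX leq_mul //.
  rewrite cardsU (_ : _ :&: _ = finset.set0) ?cards0 ?subn0; last first.
    by apply/setP => x; rewrite !inE /c0 /s; lia.
  by rewrite addnC leq_add // card_ord_itv_ge // /c0 /s /qdim; lia.
have [|f1 f1_inj f1_sub] := @subset_labels _ D1 M1.
  by apply: leq_trans M1_le _; rewrite leq_exp2l.
have [|f2 f2_inj f2_sub] := @subset_labels _ D2 M2.
  by apply: leq_trans M2_le _; rewrite leq_exp2l.
have E1_range w t i : mem_pos (f1 w) t i -> (q - m <= i)%N && ~~ jam t i.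
  move=> /mem_posP[x /(fintype.subsetP (f1_sub w))]; rewrite !inE => H [<- <-].
  by move: H => /andP[]; rewrite negb_and => H /andP[_ /andP[H1 H2]]; move: H; rewrite H1 H2.
have E2_range w t j : mem_pos (f2 w) t j ->
    [/\ (0 < t)%N, (n - m <= j < m)%N & (n - m + c0 <= j < n)%N -> mem_pos J t j].
  move=> /mem_posP[x /(fintype.subsetP (f2_sub w))]; rewrite inE => H [e1 e2].
  case/orP: H => [|xJ]; last first.
    have xJ' : mem_pos J t j by rewrite -e1 -e2 mem_posE.
    by have [t0 j_ge j_lt] := J_range _ _ xJ'; split => //; lia.
  by rewrite !inE e1 e2 => H; split; [lia|move: H; rewrite /c0 /s; lia|move=> ?; exfalso; lia].
exists (@scheme m n C N M1 M2 (Ordinal M1_gt0) (Ordinal M2_gt0)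
  (fun w => mem_pos (f1 w)) (fun w => mem_pos (f2 w)) (mem_pos J)).
have J_range' t j : mem_pos J t j -> (n - m + c0 <= j)%N by case/J_range.
have f1_inj' w w' := fun e => f1_inj w w' (@mem_pos_inj (f1 w) (f1 w') e).
have f2_inj' w w' := fun e => f2_inj w w' (@mem_pos_inj (f2 w) (f2 w') e).
split; [exact: scheme_Perr|exact: leak1_eq0|exact: scheme_leak2].
Qed.

(** Perfect secrecy is demanded at every block length; this code serves those too short for the
    scheme. *)
Lemma silent_exists (R : realType) M1 M2 : (0 < M1)%N -> (0 < M2)%N ->
  exists c : Defs.code m n C N M1 M2, leak1 (R := R) c = 0 /\ leak2 (R := R) c = 0.
Proof.
move=> M1_gt0 M2_gt0.
pose c := @Code m n C N M1 M2 0 0 (fun _ _ _ => 0) (fun _ _ _ => nseq_tuple C false)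
  (fun _ _ _ _ => 0) (fun _ _ _ _ _ _ => erefl) (fun=> Ordinal M1_gt0) (fun=> Ordinal M2_gt0).
exists c; split; first exact: leak1_eq0.
apply: (@mutinf_indep _ _ _ _ _ _ (fun o : omega c => o.1.1.2)
          (fun o : omega c => (o.1.1.1, o.1.2, o.2))).
- exact: card_omega_gt0.
- by move=> [[[? ?] ?] ?] [[[? ?] ?] ?] [] /= -> -> -> ->.
- by rewrite !card_prod; lia.
- by move=> o o'.
- by move=> o o' _; apply/ffunP => t; rewrite !ffunE.
Qed.

End SchemeExists.

(** * Rates and capacity regions *)

Local Open Scope classical_set_scope.

(** * Message counts and rates *)

Section Msgs.
Variable R : realType.
Implicit Types (N : nat) (r : R).

Lemma powR2_gt0 (x : R) : 0 < 2 `^ x.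
Proof. by rewrite powR_gt0. Qed.

Lemma msgsE N r : (msgs N r)%:R = (Num.ceil (2 `^ (N%:R * r)))%:~R :> R.
Proof.
rewrite /msgs natr_absz ger0_norm // ceil_ge0.
by apply: lt_trans (powR2_gt0 _); lra.
Qed.

Lemma msgs_ge N r : 2 `^ (N%:R * r) <= (msgs N r)%:R :> R.
Proof. by rewrite msgsE ceil_ge. Qed.

Lemma msgs_gt0 N r : (0 < msgs N r)%N.
Proof. by rewrite -(ltr0n R) (lt_le_trans (powR2_gt0 _) (msgs_ge N r)). Qed.

Lemma msgs_le N r k : N%:R * r <= k%:R -> (msgs N r <= 2 ^ k)%N.
Proof.
move=> rk; rewrite -(ler_nat R) msgsE [leRHS]pmulrn ler_int ceil_le_int -pmulrn.
by rewrite natrX -powR_mulrn // ler_powR //; lra.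
Qed.

Lemma ln_msgs_ge N r : N%:R * r * ln 2 <= ln (msgs N r)%:R.
Proof. by rewrite -ln_powR ler_ln ?posrE ?powR2_gt0 ?msgs_ge // ltr0n msgs_gt0. Qed.

Lemma ln_msgs_le N r : 0 <= r -> ln (msgs N r)%:R <= N%:R * r * ln 2 + ln 2.
Proof.
move=> r0; have M0 : 0 < (msgs N r)%:R :> R by rewrite ltr0n msgs_gt0.
rewrite -ln_powR -lnM ?posrE ?powR2_gt0 // ler_ln ?posrE ?mulr_gt0 ?powR2_gt0 //.
have ge1 : 1 <= 2 `^ (N%:R * r).
  by rewrite -[leLHS](powRr0 2) ler_powR ?mulr_ge0 //; lra.
have := @ceilB1_lt _ (2 `^ (N%:R * r)).
rewrite msgsE intrB; lra.
Qed.

End Msgs.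

Lemma ler_addMgt0 (R : realType) (x y K : R) :
  (forall e, 0 < e -> e < 1 -> x <= y + e * K) -> x <= y.
Proof.
move=> xyK; rewrite leNgt; apply/negP => yx.
have K0 : 0 < K by have := xyK (2^-1); rewrite ?invr_gt0; lra.
pose e := Num.min ((x - y) / (2 * K)) 2^-1.
have e0 : 0 < e by rewrite /e lt_min !divr_gt0 ?subr_gt0 //= ?mulr_gt0 ?invr_gt0.
have e1 : e < 1 by rewrite /e gt_min; apply/orP; right; lra.
have eK : e * K <= (x - y) / 2.
  have : e <= (x - y) / (2 * K) by rewrite /e ge_min lexx.
  by rewrite invfM mulrA ler_pdivlMr.
have := xyK e e0 e1; lra.
Qed.

(** * The outer bound under weak secrecy *)

Section WeakConverse.
Variables (R : realType) (m n C : nat).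

Lemma Perr_ge0 N M1 M2 (c : Defs.code m n C N M1 M2) : 0 <= Perr (R := R) c.
Proof. by rewrite /Perr probE divr_ge0. Qed.

Lemma weak_converse (r : R * R) : achievable m n C Weak r ->
  [/\ r.1 <= m%:R, r.2 <= (m - (n - m))%:R & r.1 + r.2 <= m%:R + C%:R + (m - n)%:R].
Proof.
case: r => r1 r2 [/= r1_ge0 [r2_ge0 [cd [cvg_err [_ cvg_leak]]]]].
have ln2 : 0 < ln 2 :> R by rewrite ln_gt0 // ltr1n.
(* In units of [N * ln 2], each [ln 2] costs [e], the leakage [e], and the error term of message [i]
   at most [e * (r_i + 1)]. *)
have bounds (e : R) : 0 < e -> e < 1 ->
  [/\ r1 <= m%:R + e * (r1 + 2), r2 <= (m - (n - m))%:R + e * (r2 + 3) &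
      r1 + r2 <= m%:R + C%:R + (m - n)%:R + e * (2 * (r1 + 2) + (r2 + 3))].
  move=> e0 e1.
  have el0 : 0 < e * ln 2 by rewrite mulr_gt0.
  have /cvgrPdist_le /(_ _ e0) err_e := cvg_err.
  have /cvgrPdist_le /(_ _ el0) leak_e := cvg_leak.
  have /(filterI err_e)/(filterI leak_e) := nbhs_infty_ger e^-1.
  rewrite near_simpl => -[N0 _ /(_ N0 (leqnn _))] /=.
  set N := N0; set c := cd N.
  rewrite !sub0r !normrN => -[leakN [errN eN]].
  have N0' : 0 < N%:R :> R by apply: lt_le_trans eN; rewrite invr_gt0.
  have [] := converse_bounds R c (msgs_gt0 _ _) (msgs_gt0 _ _).
  have := ln_msgs_ge N r1; have := ln_msgs_ge N r2.
  have := ln_msgs_le N r1_ge0; have := ln_msgs_le N r2_ge0.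
  have := Perr_ge0 c; move: errN; set pe := Perr c => errN pe0.
  have {}errN : pe <= e by apply: le_trans errN; rewrite ler_norm.
  have {leakN} : leak2 c <= e * (N%:R * ln 2).
    have : leak2 c / N%:R <= e * ln 2 by apply: le_trans leakN; rewrite ler_norm.
    rewrite ler_pdivrMr //; lra.
  have {eN} : ln 2 <= e * (N%:R * ln 2).
    have : 1 <= e * N%:R by rewrite mulrC -ler_pdivrMr // div1r.
    by rewrite mulrA => eN1; rewrite ler_peMl ?(ltW ln2).
  have L0 : 0 < N%:R * ln 2 :> R by rewrite mulr_gt0.
  have -> : N%:R * r1 * ln 2 = N%:R * ln 2 * r1 by ring.
  have -> : N%:R * r2 * ln 2 = N%:R * ln 2 * r2 by ring.
  have Nk k : N%:R * k%:R * ln 2 = N%:R * ln 2 * k%:R :> R by ring.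
  rewrite !Nk.
  move: L0; set L := N%:R * ln 2 => L0 leL lkL u2 u1 l2 l1.
  have pe_le (l s : R) : l <= L * s + ln 2 -> 0 <= s -> 0 <= l -> pe * l <= L * (e * (s + 1)).
    move=> ls s0 l0; apply: (@le_trans _ _ (e * l)); first by rewrite ler_wpM2r.
    rewrite [leRHS]mulrCA ler_wpM2l ?(ltW e0) //.
    apply: le_trans ls _; rewrite mulrDr lerD2l mulr1.
    apply: le_trans leL _; rewrite ler_piMl ?(ltW L0) ?(ltW e1) //.
  have p1 := pe_le _ _ u1 r1_ge0; have p2 := pe_le _ _ u2 r2_ge0.
  have {}p1 := p1 (le_trans (mulr_ge0 (ltW L0) r1_ge0) l1).
  have {}p2 := p2 (le_trans (mulr_ge0 (ltW L0) r2_ge0) l2).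
  move=> c1 c2 c3; split.
  - rewrite -(ler_pM2l L0); lra.
  - rewrite -(ler_pM2l L0); lra.
  - rewrite -(ler_pM2l L0); lra.
split.
- by apply: (@ler_addMgt0 _ _ _ (r1 + 2)) => e e0 e1; have [] := bounds e e0 e1.
- by apply: (@ler_addMgt0 _ _ _ (r2 + 3)) => e e0 e1; have [] := bounds e e0 e1.
- by apply: (@ler_addMgt0 _ _ _ (2 * (r1 + 2) + (r2 + 3)))
    => e e0 e1; have [] := bounds e e0 e1.
Qed.

End WeakConverse.

(** * Achievability inside the polygon and comparison of closures *)

Section Region.
Variables (R : realType) (m n C : nat).
Let s := (minn m n - (n - m))%N.
Let c0 := minn C s.

Lemma ceil_nat_ex (x : R) : 0 <= x -> exists K : nat, x <= K%:R < x + 1 /\ (x = 0 -> K = 0%N).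
Proof.
move=> x0; have c_ge0 : 0 <= Num.ceil x by rewrite ceil_ge0; lra.
exists `|Num.ceil x|%N; split; last by move=> ->; rewrite ceil0.
rewrite natr_absz ger0_norm // ceil_ge /=.
by have := ceilB1_lt x; rewrite intrB; lra.
Qed.

Lemma perfect_achievable (r : R * R) : 0 <= r.1 -> r.1 <= m%:R -> 0 <= r.2 ->
  (r.2 = 0 \/ r.2 < (m - (n - m))%:R) -> r.1 + r.2 < (m + (m - n) + c0)%:R ->
  achievable m n C Perfect r.
Proof.
case: r => r1 r2 /= r1_ge0 r1_le r2_ge0 r2_lt sum_lt.
pose p := (m - n + c0)%N; pose d := (m - (n - m))%N.
(* The summands 1 and 2 absorb rounding [N * r1] and [N * r2] up to integers. *)
pose large (N : nat) := (r2 = 0 \/ N%:R * r2 + 1 <= N.-1%:R * d%:R) /\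
  N%:R * r1 + N%:R * r2 + 2 <= N%:R * m%:R + N.-1%:R * p%:R.
have codes N : exists c : Defs.code m n C N (msgs N r1) (msgs N r2),
    [/\ leak1 (R := R) c = 0, leak2 (R := R) c = 0 & large N -> Perr (R := R) c = 0].
  have [[N2 N12]|nlarge] := pselect (large N); last first.
    have [c [l1 l2]] := @silent_exists m n C N R _ _ (msgs_gt0 N r1) (msgs_gt0 N r2).
    by exists c; split.
  have [|K1 [/andP[K1_ge K1_lt] _]] := @ceil_nat_ex (N%:R * r1); first by rewrite mulr_ge0.
  have [|K2 [/andP[K2_ge K2_lt] K2_0]] := @ceil_nat_ex (N%:R * r2); first by rewrite mulr_ge0.
  have K1_le : (K1 <= N * m)%N.
    rewrite -ltnS -(ltr_nat R) -[X in _ < X]natr1 natrM; apply: lt_le_trans K1_lt _.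
    by rewrite lerD2r ler_wpM2l.
  have K12_le : (K1 + K2 <= N * m + N.-1 * p)%N.
    by rewrite -(ler_nat R) !natrD !natrM; lra.
  have K2_le : (K2 <= N.-1 * d)%N.
    case: N2 => [r20|N2]; first by rewrite K2_0 // r20 mulr0.
    by rewrite -(ler_nat R) natrM; lra.
  have d_p : (N.-1 * d = N.-1 * p + N.-1 * (s - c0))%N.
    by rewrite -mulnDr; congr (_ * _)%N; rewrite /d /p /c0 /s; clear; lia.
  (* Jam only for the part of message 2 exceeding the [p] levels per slot that need no jamming. *)
  have [||||| c [e0 e1 e2]] := @scheme_exists m n C N R (msgs N r1) (msgs N r2)
      (K2 - N.-1 * p)%N; try exact: msgs_gt0; last by exists c; split.
  - by rewrite leq_subLR -d_p.
  - apply: leq_trans (msgs_le K1_ge) _; rewrite leq_exp2l //; clear -K1_le K12_le; lia.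
  - apply: leq_trans (msgs_le K2_ge) _; rewrite leq_exp2l // -/s -/c0 -/p; clear; lia.
do 2!split => //; exists (fun N => projT1 (cid (codes N))).
split; last by move=> N; case: cid => c [].
have [Na Na_large] : exists Na : nat, forall N, (Na <= N)%N -> large N.
  have pos_ge (x y : R) : 0 < x -> \forall N \near \oo, y <= N%:R * x.
    by move=> x0; near do rewrite -ler_pdivrMr //; exact: nbhs_infty_ger.
  have near1 : \forall N \near \oo, (0 < N)%N by exact: nbhs_infty_gt.
  have near_sum : \forall N \near \oo, 2 + p%:R <= N%:R * (m%:R + p%:R - r1 - r2) :> R.
    by apply: pos_ge; move: sum_lt; rewrite -addnA natrD -/p; lra.
  have predR (N : nat) : (0 < N)%N -> N.-1%:R = N%:R - 1 :> R.
    by case: N => // N _; rewrite -[in RHS]natr1 addrK.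
  have near_r2 : \forall N \near \oo, r2 = 0 \/ N%:R * r2 + 1 <= N.-1%:R * d%:R.
    case: r2_lt => [->|r2_lt]; first by near=> N; left.
    have : \forall N \near \oo, 1 + d%:R <= N%:R * (d%:R - r2) :> R.
      by apply: pos_ge; rewrite subr_gt0.
    move=> near_d; near=> N; right.
    have N0 : (0 < N)%N by near: N.
    have : 1 + d%:R <= N%:R * (d%:R - r2) :> R by near: N.
    by rewrite predR //; lra.
  have : \forall N \near \oo, large N.
    near=> N; split; first by near: N.
    have N0 : (0 < N)%N by near: N.
    have : 2 + p%:R <= N%:R * (m%:R + p%:R - r1 - r2) :> R by near: N.
    by rewrite predR //; lra.
  by move=> [Na _ Na_large]; exists Na.
apply: cvg_near_cst; exists Na => // N /= /Na_large.
by case: cid => c [].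
Unshelve. all: by end_near. Qed.

Lemma weak_sub_closure_perfect (r : R * R) : (0 < m)%N ->
  achievable m n C Weak r -> closure [set x : R * R | achievable m n C Perfect x] r.
Proof.
move=> m0 weak; have [r1_le r2_le sum_le] := weak_converse weak.
case: weak => r1_ge0 [r2_ge0 _].
move=> B /nbhs_ballP[e /= e0 eB].
case: r r1_le r2_le sum_le r1_ge0 r2_ge0 eB => r1 r2 /= r1_le r2_le sum_le r1_ge0 r2_ge0 eB.
pose D := e + r1 + r2 + 1; have D0 : 0 < D by rewrite /D; lra.
(* Scaling by [1 - t] makes the needed bounds strict, and this [t] moves each coordinate by less
   than [e]. *)
pose t := e / D; have t0 : 0 < t by rewrite divr_gt0.
have t1 : t < 1 by rewrite ltr_pdivrMr // /D; lra.
have small x : 0 <= x -> x <= r1 + r2 -> `|x - (1 - t) * x| < e.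
  move=> x0 xr; rewrite (_ : _ - _ = t * x); last by ring.
  have tx0 : 0 <= t * x by exact: mulr_ge0 (ltW t0) x0.
  rewrite ger0_norm // /t mulrAC ltr_pdivrMr // ltr_pM2l // /D; lra.
exists ((1 - t) * r1, (1 - t) * r2); split; last first.
  by apply: eB; split => /=; apply: small => //; lra.
have tr1 : 0 <= t * r1 by exact: mulr_ge0 (ltW t0) r1_ge0.
apply: perfect_achievable => /=.
- by rewrite mulr_ge0 //; lra.
- lra.
- by rewrite mulr_ge0 //; lra.
- have [->|r20] := eqVneq r2 0; [left; exact: mulr0|right].
  have : 0 < t * r2 by rewrite mulr_gt0 // lt_neqAle eq_sym r20.
  lra.
have S0 : 0 < (m + (m - n) + c0)%:R :> R by rewrite ltr0n; clear -m0; lia.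
have S_ge : r1 + r2 <= (m + (m - n) + c0)%:R.
  (* If [C >= s], the bound follows from the two individual rate bounds. *)
  rewrite /c0 /minn; case: ifP => _; first by rewrite !natrD; lra.
  have -> : (m + (m - n) + s = m + (m - (n - m)))%N by rewrite /s; clear; lia.
  by rewrite natrD; lra.
rewrite -mulrDr; apply: le_lt_trans (_ : _ <= (1 - t) * (m + (m - n) + c0)%:R) _.
  by rewrite ler_wpM2l //; lra.
by rewrite gtr_pMl //; lra.
Qed.

End Region.

Theorem theorem4 (R : realType) (m n C : nat) : (1 <= m)%N ->
  capacity_region (R := R) m n C Perfect = capacity_region (R := R) m n C Strong /\
  capacity_region (R := R) m n C Strong = capacity_region (R := R) m n C Weak.
Proof.
move=> m1; rewrite /capacity_region.
have PS : [set r : R * R | achievable m n C Perfect r] `<=`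
    [set r | achievable m n C Strong r].
  move=> r [r1 [r2 [cd [err perfect]]]]; split => //; split => //; exists cd; split => //.
  by split; apply: cvg_near_cst; near=> N; case: (perfect N).
have SW : [set r : R * R | achievable m n C Strong r] `<=`
    [set r | achievable m n C Weak r].
  move=> r [r1 [r2 [cd [err [l1 l2]]]]]; split => //; split => //; exists cd; split => //.
  have div_cvg (u : nat -> R) : u @ \oo --> (0 : R) -> (fun N => u N / N%:R) @ \oo --> (0 : R).
    move=> /cvgrPdist_le u0; apply/cvgrPdist_le => e /u0; apply: filterS => N.
    rewrite !sub0r !normrN normrM => uN; apply: le_trans uN.
    rewrite ler_piMr // ger0_norm ?invr_ge0 //.
    (* At [N = 0] the quotient is 0, since [0^-1 = 0]. *)
    by case: N => [|N]; rewrite ?invr0 // invf_le1 // ler1n.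
  by split; apply: div_cvg.
have WP : closure [set r : R * R | achievable m n C Weak r]
    `<=` closure [set r | achievable m n C Perfect r].
  rewrite [X in _ `<=` X](closure_id _).1; last exact: closed_closure.
  by apply: closure_subset => r /=; exact: weak_sub_closure_perfect.
split; apply/seteqP; split; try exact: closure_subset.
- by apply: subset_trans WP; exact: closure_subset.
- by apply: subset_trans WP _; exact: closure_subset.
Unshelve. all: by end_near. Qed.
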